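(* Let $\mathcal{G}=\bigcup_{d\ge1}\mathcal{G}_d$ be a graded family of connected graphs that is tethered, with tethering $\{f_d(x)\}_{d\ge1}$. For fixed positive integers $n,d$, define $g_{n,d}$ on $[1,\infty)$ by \[ g_{n,d}(x)=\frac{n}{f_d(x)}+2x, \] and suppose $g_{n,d}$ achieves a minimum at some point $m_{n,d}\in[1,\infty)$. Let $M_{n,d}$ be any upper bound on both of the values \[ \lceil m_{n,d}\rceil \quad\text{and}\quad \min\{g_{n,d}(\lfloor m_{n,d}\rfloor),\, g_{n,d}(\lceil m_{n,d}\rceil)\}. \] Then every graph $G\in\mathcal{G}_d$ on $n$ vertices satisfies $b(G)\le M_{n,d}$.
   Context: Graphs are finite, simple, undirected and connected. Burning process on a graph $G$: in round 1 one vertex is chosen and set on fire; in each subsequent round, first every burning vertex sets all its neighbours on fire, then one new vertex is chosen and set on fire; the process ends when all vertices are on fire. The burning number $b(G)$ is the minimum number of rounds needed. For vertices $u,v$, $d(u,v)$ is the graph distance; $\mathrm{ecc}(v)=\max_u d(u,v)$; $\mathrm{rad}(G)=\min_v \mathrm{ecc}(v)$. The closed $r$-neighborhood of $v$ is $N_r(v)=\{u: d(u,v)\le r\}$. A graded family of connected graphs is a class of connected graphs written as a union $\mathcal{G}=\bigcup_{d=1}^\infty \mathcal{G}_d$. Such a family is tethered if there exist functions $f_1(x),f_2(x),\dots$ defined on $[1,\infty)$ such that for every positive integer $d$, every $G\in\mathcal{G}_d$, every $r\in\{1,2,\dots,\mathrm{rad}(G)\}$ and every $v\in V(G)$, one has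 $|N_r(v)|\ge f_d(r)$; the functions $\{f_d\}_{d\ge1}$ are then called a tethering for $\mathcal{G}$.
   Formalization: The formal theorem additionally assumes f_d(x) > 0 for all x ≥ 1; without positivity the claim fails, e.g. G = K_2, n = 2, f_d = −1 gives m = 1 and allows M = 1, while b(K_2) = 2. *)

(* Defs.v *)
From mathcomp Require Import all_boot all_order all_algebra.
From mathcomp Require Import reals.

Set Implicit Arguments.
Unset Strict Implicit.
Unset Printing Implicit Defensive.

Import Order.TTheory GRing.Theory Num.Theory.

Record graph := Graph {
  vertex :> finType;
  adj : rel vertex;
  adj_sym : symmetric adj;
  adj_irr : irreflexive adj;
  vertex_gt0 : 0 < #|vertex|;
  adj_connected : forall u v : vertex, connect adj u v
}.

Section Metric.
Variable G : graph.

Definition walk (u v : G) (k : nat) : bool :=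
  [exists p : k.-tuple G, path (@adj G) u p && (last u p == v)].

Lemma walk_ex (u v : G) : exists k, walk u v k.
Proof.
have /connectP[p up vE] := adj_connected u v.
exists (size p); apply/existsP; exists (in_tuple p).
by rewrite /= up vE eqxx.
Qed.

Definition dist (u v : G) : nat := ex_minn (walk_ex u v).

Definition ecc (v : G) : nat := \max_(u : G) dist u v.

Lemma ecc_ex : exists k, [exists v : G, ecc v == k].
Proof.
have /card_gt0P[v _] := vertex_gt0 G.
by exists (ecc v); apply/existsP; exists v.
Qed.

Definition rad : nat := ex_minn ecc_ex.

Definition nbhd (r : nat) (v : G) : {set G} := [set u | dist u v <= r].

End Metric.

Section Burning.
Variable G : graph.
Implicit Types B : {set G}.

Definition spread B : {set G} := B :|: [set v | [exists u in B, adj u v]].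

(* [B'] can be the set of burning vertices at the end of a round that starts
   with [B] burning. If the spread already burns every vertex, there is no new
   vertex left to choose. *)
Definition burn_round B B' : bool :=
  if spread B == [set: G] then B' == [set: G]
  else [exists x, (x \notin spread B) && (B' == x |: spread B)].

(* The process starts with no vertex on fire: since [spread set0 = set0], the
   first round only sets one chosen vertex on fire. *)
Definition burns_in (k : nat) : bool :=
  [exists s : k.-tuple {set G},
     path burn_round set0 s && (last set0 s == [set: G])].

Lemma burns_ex : exists k, burns_in k.
Proof.
suff [s sP]: exists s, path burn_round set0 s && (last set0 s == [set: G]).
  by exists (size s); apply/existsP; exists (in_tuple s).
move: set0 => B; move: {2}_.+1 (ltnSn #|~: B|) => n.
elim: n B => // n IHn B; rewrite ltnS => leBn.
have [BT | BnT] := boolP (spread B == [set: G]).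
  by exists [:: [set: G]]; rewrite /= /burn_round BT !eqxx.
have /subsetPn[x _ xB]: ~~ ([set: G] \subset spread B) by rewrite subTset.
have [|s /andP[sP sT]] := IHn (x |: spread B).
  apply: leq_trans leBn; apply: proper_card; rewrite properC.
  apply/properP; split; last exists x; rewrite ?setU11 //.
    by apply/subsetP => y yB; rewrite !inE yB orbT.
  by apply: contra xB => xB; rewrite inE xB.
exists (x |: spread B :: s); rewrite /= sP sT !andbT /burn_round (negPf BnT).
by apply/existsP; exists x; rewrite xB eqxx.
Qed.

Definition burning_number : nat := ex_minn burns_ex.

End Burning.

(* [F d] is the d-th grade; only the indices d >= 1 are meaningful. *)
Definition graded_family := nat -> graph -> Prop.

Local Open Scope ring_scope.

(* Functions defined on [1, +oo) are total functions on R whose values below 1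
   are never used. *)
Definition tethering (R : realType) (F : graded_family) (f : nat -> R -> R) :=
  forall d : nat, (0 < d)%N ->
  forall G : graph, F d G ->
  forall r : nat, (1 <= r <= rad G)%N ->
  forall v : G, f d r%:R <= #|nbhd r v|%:R.

Definition gfun (R : realType) (f : nat -> R -> R) (n d : nat) (x : R) : R :=
  n%:R / f d x + 2 * x.

(* Main.v *)
Require Import Defs.
From mathcomp Require Import all_boot all_order all_algebra.
From mathcomp Require Import reals.

Set Implicit Arguments.
Unset Strict Implicit.
Unset Printing Implicit Defensive.

Import Order.TTheory GRing.Theory Num.Theory.
Local Open Scope ring_scope.

(** Let [r] be whichever of [floor m] and [ceil m] gives the smaller value of
    [g]. If [r > rad G], igniting a center of [G] first burns everything within
    [rad G + 1 <= r <= ceil m] rounds. Otherwise take a maximal set [S] of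
    vertices at pairwise distance greater than [2r]: the [r]-balls around [S]
    are disjoint and have at least [f_d r] vertices each, so
    [#|S| <= n / f_d r], while by maximality the [2r]-balls around [S] cover
    [G]. Igniting the vertices of [S] one after the other and then waiting [2r]
    rounds burns [G] within [g r] rounds. *)

Section Distance.
Local Open Scope nat_scope.
Variable G : graph.
Implicit Types (u v w x y : G) (r : nat).

Lemma walkP u v k :
  reflect (exists p, [/\ path (@adj G) u p, last u p = v & size p = k])
          (walk u v k).
Proof.
apply: (iffP existsP) => [[p /andP[up /eqP vE]]|[p [up vE <-]]].
  by exists p; rewrite size_tuple.
by exists (in_tuple p); rewrite up vE eqxx.
Qed.

Lemma dist_walk u v : walk u v (dist u v).
Proof. by rewrite /dist; case: ex_minnP. Qed.

Lemma dist_le u v k : walk u v k -> dist u v <= k.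
Proof. by rewrite /dist; case: ex_minnP => l _; apply. Qed.

Lemma dist_refl v : dist v v = 0.
Proof.
by apply/eqP; rewrite -leqn0; apply/dist_le/walkP; exists [::].
Qed.

Lemma walk_sym u v k : walk u v k -> walk v u k.
Proof.
(* A path omits its starting vertex, so the reversed one must drop [v] and end in [u], which is what
   [belast] provides. *)
move=> /walkP[p [up <- <-]]; apply/walkP; exists (rev (belast u p)); split.
- by rewrite rev_path (eq_path (e' := @adj G)) // => x y; rewrite adj_sym.
- by case: p {up} => //= x p; rewrite rev_cons last_rcons.
- by rewrite size_rev size_belast.
Qed.

Lemma dist_sym u v : dist u v = dist v u.
Proof.
by apply/eqP; rewrite eqn_leq; apply/andP; split;
  apply/dist_le/walk_sym/dist_walk.
Qed.

Lemma dist_triangle w u v : dist u v <= dist u w + dist w v.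
Proof.
have /walkP[p [up pE <-]] := dist_walk u w.
have /walkP[q [wq qE <-]] := dist_walk w v.
apply/dist_le/walkP; exists (p ++ q); split; last by rewrite size_cat.
  by rewrite cat_path up pE.
by rewrite last_cat pE.
Qed.

Lemma center_exists : exists v, forall u, dist u v <= Defs.rad G.
Proof.
rewrite /Defs.rad; case: ex_minnP => k /existsP[v /eqP<-] _; exists v => u.
by rewrite /ecc (bigD1 u) //= leq_maxl.
Qed.

(** Boolean-valued, so that [maxset_exists] yields a maximal packing. *)
Definition packing r (S : {set G}) : bool :=
  [forall x in S, forall y in S, (dist x y <= 2 * r) ==> (x == y)].

Lemma packingP r (S : {set G}) :
  reflect {in S &, forall x y, dist x y <= 2 * r -> x = y} (packing r S).
Proof.
apply: (iffP forall_inP) => [SP x y xS yS xy|SP x xS].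
  exact/eqP/(implyP (forall_inP (SP x xS) y yS)).
by apply/forall_inP => y yS; apply/implyP => /(SP _ _ xS yS) ->.
Qed.

(** A vertex farther than [2 * r] from all of [S] could be added to [S], against maximality. *)
Lemma maximal_packing r :
  exists2 S, packing r S & forall v, exists2 x, x \in S & dist v x <= 2 * r.
Proof.
have P0 : packing r set0 by apply/packingP => x; rewrite inE.
have [S /maxsetP[SP maxS] _] := maxset_exists P0.
exists S => // v; apply/exists_inP; apply: contraT => /exists_inPn vS.
have v_notin : v \notin S.
  by apply/negP => /vS; rewrite dist_refl.
have /maxS : packing r (v |: S).
  apply/packingP => x y /setU1P[->|xS] /setU1P[->|yS] //.
  - by move=> vy; have := vS y yS; rewrite vy.
  - by rewrite dist_sym => vx; have := vS x xS; rewrite vx.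
  - exact: (packingP _ _ SP).
by move=> /(_ (subsetUr _ _)) SE; rewrite -SE setU11 in v_notin.
Qed.

Lemma packing_sum_card r (S : {set G}) :
  packing r S -> \sum_(x in S) #|nbhd r x| <= #|G|.
Proof.
move=> /packingP SP; rewrite -sum1_card.
under eq_bigr do rewrite -sum1_card big_mkcond /=.
(* Double counting: each [u] lies in at most one ball, since two centers within [r] of [u] are
   within [2 * r] of each other. *)
rewrite exchange_big leq_sum //= => u _; rewrite -big_mkcondr sum1_card.
apply/card_le1_eqP => x y; rewrite unfold_in => /andP[xS ux].
rewrite unfold_in => /andP[yS uy]; rewrite !inE in ux uy.
apply: SP => //; rewrite mul2n -addnn.
by apply: leq_trans (dist_triangle u _ _) _; rewrite leq_add // dist_sym.
Qed.

End Distance.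

Section Burning.
Local Open Scope nat_scope.
Variable G : graph.
Implicit Types (u v x : G) (B : {set G}).

Lemma sub_spread B : B \subset spread B.
Proof. exact: subsetUl. Qed.

Lemma spreadS B B' : B \subset B' -> spread B \subset spread B'.
Proof.
move=> sBB'; apply: setUSS => //; apply/subsetP => v; rewrite !inE.
move=> /exists_inP[u uB uv]; apply/exists_inP; exists u => //.
exact: (subsetP sBB').
Qed.

Lemma sub_iter_spread k l B :
  k <= l -> iter k (@spread G) B \subset iter l (@spread G) B.
Proof.
move=> /subnK <-; elim: (l - k) => // j IHj.
by rewrite addSn iterS (subset_trans IHj) ?sub_spread.
Qed.

(** The fire travels from [v] back along a shortest walk from [u], one edge per spread. *)
Lemma nbhd_sub_iter_spread k B v :
  v \in B -> nbhd k v \subset iter k (@spread G) B.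
Proof.
move=> vB; apply/subsetP => u; rewrite inE => uvk.
apply: (subsetP (sub_iter_spread B uvk)).
have /walkP[p [up pE <-]] := dist_walk u v; rewrite -pE in vB.
elim: p u up vB {uvk pE} => //= x p IHp u /andP[ux xp] pB.
rewrite in_setU inE; apply/orP; right; apply/exists_inP; exists x.
  exact: IHp.
by rewrite adj_sym.
Qed.

(* A round must ignite a vertex that is not yet burning; if [x] already is,
   any other choice does. *)
Lemma burn_round_with B x :
  exists2 B', burn_round B B' & x |: spread B \subset B'.
Proof.
rewrite /burn_round; have [_|BnT] := boolP (spread B == [set: G]).
  by exists setT; rewrite ?eqxx ?subsetT.
have /subsetPn[y _ yB]: ~~ ([set: G] \subset spread B) by rewrite subTset.
pose z := if x \in spread B then y else x.
have zB : z \notin spread B by rewrite /z; case: ifP => // ->.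
exists (z |: spread B); first by apply/existsP; exists z; rewrite zB eqxx.
rewrite subUset sub1set subsetUr andbT /z.
by case: ifP => xB; rewrite ?setU11 // in_setU1 xB orbT.
Qed.

(** One round per element of [s]. The last inclusion carries the induction: it keeps earlier sources
    burning, and it later measures the spread during waiting rounds. *)
Lemma burn_sources (s : seq G) B :
  exists p, [/\ path (@burn_round G) B p, size p = size s,
    {subset s <= last B p} &
    iter (size s) (@spread G) B \subset last B p].
Proof.
elim: s B => [|x s IHs] B; first by exists [::].
have [B' BB'] := burn_round_with B x.
rewrite subUset sub1set => /andP[xB' sB'].
have [p [B'p sz_p sp itp]] := IHs B'; exists (B' :: p); split => /=.
- by rewrite BB'.
- by rewrite sz_p.
- move=> y /[!inE] /predU1P[->|/sp//].
  exact/(subsetP itp)/(subsetP (sub_iter_spread B' (leq0n _))).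
- apply: subset_trans itp; rewrite -iterS iterSr.
  by elim: (size s) => //= k; apply: spreadS.
Qed.

Lemma burning_number_cover (S : {set G}) t :
  (forall v, exists2 x, x \in S & dist v x <= t) ->
  burning_number G <= #|S| + t.
Proof.
move=> S_cover; have /card_gt0P[v0 _] := vertex_gt0 G.
have [p [ip sz_p sp _]] := burn_sources (enum S) set0.
(* The [t] waiting rounds: [v0] is only a nominal choice, and the fire from [S] spreads [t]
   times. *)
have [q [pq sz_q _ itq]] := burn_sources (nseq t v0) (last set0 p).
rewrite size_nseq in sz_q itq.
rewrite /burning_number; case: ex_minnP => k _; apply.
have sz : size (p ++ q) == #|S| + t by rewrite size_cat sz_p sz_q cardE.
apply/existsP; exists (Tuple sz); rewrite /= cat_path ip pq last_cat.
rewrite -subTset; apply/subsetP => v _; have [x xS vx] := S_cover v.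
apply: (subsetP itq); apply: (subsetP (nbhd_sub_iter_spread t (v := x) _)).
  by apply: sp; rewrite mem_enum.
by rewrite inE.
Qed.

Lemma burning_number_rad : burning_number G <= (Defs.rad G).+1.
Proof.
have [c cP] := center_exists G; rewrite -add1n -(cards1 c).
by apply: burning_number_cover => v; exists c; rewrite ?inE.
Qed.

End Burning.

(** Disjointness of the balls gives [#|S| * a <= #|G|]; [a] stands for the tethering bound at
    [r]. *)
Lemma burning_number_packing (R : realType) (G : graph) (r : nat) (a : R) :
  0 < a -> (forall v : G, a <= #|nbhd r v|%:R) ->
  (burning_number G)%:R <= #|G|%:R / a + 2 * r%:R.
Proof.
move=> a_gt0 a_le; have [S SP S_cover] := maximal_packing G r.
apply: le_trans (_ : #|S|%:R + 2 * r%:R <= _).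
  by rewrite -natrM -natrD ler_nat; apply: burning_number_cover.
rewrite lerD2r ler_pdivlMr //.
apply: le_trans (_ : (\sum_(x in S) #|nbhd r x|)%:R <= _); last first.
  by rewrite ler_nat packing_sum_card.
by rewrite natr_sum mulr_natl -sumr_const ler_sum.
Qed.

Theorem theorem5 (R : realType) (F : graded_family) (f : nat -> R -> R)
    (Ff : tethering F f) (n d : nat) (n_gt0 : (0 < n)%N) (d_gt0 : (0 < d)%N)
    (f_gt0 : forall x : R, 1 <= x -> 0 < f d x)
    (m : R) (m_ge1 : 1 <= m)
    (m_min : forall x : R, 1 <= x -> gfun f n d m <= gfun f n d x)
    (M : R) (M_ceil : (Num.ceil m)%:~R <= M)
    (M_min : Num.min (gfun f n d (Num.floor m)%:~R)
                     (gfun f n d (Num.ceil m)%:~R) <= M)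
    (G : graph) (FG : F d G) (Gn : #|G| = n) :
  (burning_number G)%:R <= M.
Proof.
have floor_ge1 : 1 <= Num.floor m by rewrite floor_ge_int.
have floor_le_ceil : Num.floor m <= Num.ceil m.
  by rewrite -(ler_int R); apply: le_trans (floor_le m) (ceil_ge m).
(* Handles floor and ceiling at once; [1 <= z] turns [z] into a natural radius. *)
have bound (z : int) :
    1 <= z -> z <= Num.ceil m -> gfun f n d z%:~R <= M ->
    (burning_number G)%:R <= M.
  case: z => // r; rewrite lez_nat => r_ge1 r_le gM.
  (* The tethering only speaks of radii up to [rad G]; beyond that, the bound on the ceiling takes
     over. *)
  have [r_rad|rad_r] := leqP r (Defs.rad G).
    apply: le_trans gM; rewrite /gfun -Gn; apply: burning_number_packing.
      by apply: f_gt0; rewrite (ler_nat _ 1).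
    by move=> v; apply: Ff; rewrite ?r_ge1.
  apply: le_trans M_ceil; apply: le_trans (_ : r%:R <= _).
    by rewrite ler_nat (leq_trans (burning_number_rad G)).
  by rewrite -(ler_int R) in r_le.
move: M_min; rewrite ge_min => /orP[] /bound; apply=> //.
exact: le_trans floor_le_ceil.
Qed.
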